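(* Let $R$ be a unital associative ring, $M$ a nonzero finitely generated left $R$-module, $\Omega = \mathbb{Z}^+$, $N = \bigoplus_{\alpha\in\Omega} M_\alpha$ with each $M_\alpha = M$, and $E = \mathrm{End}_R(N)$. Let $\bar{T}\subseteq E$ be the subring of upper-triangular matrices. Then $\bar{T}\approx E$.
   Context: $\mathbb{Z}^+$ is the set of positive integers. Endomorphisms are written on the right of their arguments, so $x(fg)=(xf)g$. Each $M_\alpha$ is identified with the corresponding summand of $N$. $\bar T$ is the subring of all $f\in E$ such that $M_\alpha f\subseteq\bigoplus_{\gamma\geq\alpha} M_\gamma$ for each $\alpha\in\Omega$. For subrings $S_1,S_2\subseteq E$, $S_1\approx S_2$ means that there are finite subsets $U,U'\subseteq E$ such that $S_1\subseteq\langle S_2\cup U\rangle$ and $S_2\subseteq\langle S_1\cup U'\rangle$, where $\langle X\rangle$ is the subring generated by $X$. *)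

(* Defs.v *)
From HB Require Import structures.
From mathcomp Require Import all_boot all_order all_algebra.
From mathcomp Require Import boolp classical_sets functions cardinality.

Set Implicit Arguments.
Unset Strict Implicit.
Unset Printing Implicit Defensive.

Import Order.TTheory GRing.Theory.
Local Open Scope ring_scope.
Local Open Scope classical_set_scope.

Definition finitely_generated (R : pzRingType) (M : lmodType R) : Prop :=
  exists (n : nat) (g : 'I_n -> M),
    forall m : M, exists c : 'I_n -> R, m = \sum_(i < n) c i *: g i.

Definition finite_support (I : Type) (V : zmodType) : {pred I -> V} :=
  fun x => `[< finite_set [set i | x i != 0] >].

Fact finite_support_submod_closed (R : pzRingType) (I : Type) (M : lmodType R) :
  submod_closed (@finite_support I M).
Proof.
split; first by apply/asboolP; apply: sub_finite_set (finite_set0 I) => i /=; rewrite eqxx.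
move=> a x y /asboolP fx /asboolP fy; apply/asboolP.
have : finite_set ([set i | x i != 0] `|` [set i | y i != 0]).
  by rewrite finite_setU.
apply: sub_finite_set => i /=; rewrite !fctE.
have [-> | x0 _] := eqVneq (x i) 0; last by left.
by rewrite scaler0 add0r; right.
Qed.

HB.instance Definition _ (R : pzRingType) (I : Type) (M : lmodType R) :=
  GRing.isSubmodClosed.Build R (I -> M) (@finite_support I M)
    (GRing.submod_closed_semi (@finite_support_submod_closed R I M)).

(* The direct sum of copies of [M] indexed by [I]: the [R]-module of the
   finitely supported families [I -> M]. *)
Record dsum (R : pzRingType) (I : Type) (M : lmodType R) : Type := DSum {
  dsum_fun :> I -> M;
  dsum_finite : dsum_fun \in @finite_support I M }.

HB.instance Definition _ R I M := [isSub for @dsum_fun R I M].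
HB.instance Definition _ R I M := [Choice of @dsum R I M by <:].
HB.instance Definition _ R I M := [SubChoice_isSubLmodule of @dsum R I M by <:].

(* [{linear V -> V}] carries no ring structure in the library; [endo V] is an
   alias for it, made into the ring of endomorphisms of [V] acting on the
   right: the product of [f] and [g] is "first [f], then [g]" (lemma [endoM]). *)
Definition endo (R : pzRingType) (V : lmodType R) : Type := {linear V -> V}.

HB.instance Definition _ R V := gen_eqMixin (@endo R V).
HB.instance Definition _ R V := gen_choiceMixin (@endo R V).

Section EndoRing.
Context (R : pzRingType) (V : lmodType R).
Implicit Types f g h : endo V.

Fact endo_ext f g : f =1 g -> f = g.
Proof.
case: f g => [f [[a] [b]]] [g [[a'] [b']]] /= /funext fg.
move: a b a' b'; rewrite fg => a b a' b'.
by rewrite (Prop_irrelevance a a') (Prop_irrelevance b b').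
Qed.

Let zero : endo V := (\0 : V -> V).
Let opp f : endo V := (\- f : V -> V).
Let add f g : endo V := (f \+ g : V -> V).
Let one : endo V := (idfun : V -> V).
Let mul f g : endo V := (g \o f : V -> V).

Fact endo_addA : associative add.
Proof. by move=> f g h; apply: endo_ext => x /=; rewrite addrA. Qed.
Fact endo_addC : commutative add.
Proof. by move=> f g; apply: endo_ext => x /=; rewrite addrC. Qed.
Fact endo_add0 : left_id zero add.
Proof. by move=> f; apply: endo_ext => x /=; rewrite add0r. Qed.
Fact endo_addN : left_inverse zero opp add.
Proof. by move=> f; apply: endo_ext => x /=; rewrite addNr. Qed.

HB.instance Definition _ :=
  GRing.isZmodule.Build (endo V) endo_addA endo_addC endo_add0 endo_addN.

Fact endo_mulA : associative mul.
Proof. by move=> f g h; apply: endo_ext. Qed.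
Fact endo_mul1l : left_id one mul.
Proof. by move=> f; apply: endo_ext. Qed.
Fact endo_mul1r : right_id one mul.
Proof. by move=> f; apply: endo_ext. Qed.
Fact endo_mulDl : left_distributive mul +%R.
Proof. by move=> f g h; apply: endo_ext => x /=; rewrite linearD. Qed.
Fact endo_mulDr : right_distributive mul +%R.
Proof. by move=> f g h; apply: endo_ext. Qed.

HB.instance Definition _ := GRing.Zmodule_isPzRing.Build (endo V)
  endo_mulA endo_mul1l endo_mul1r endo_mulDl endo_mulDr.

Lemma endoD f g x : (f + g) x = f x + g x. Proof. by []. Qed.
Lemma endoN f x : (- f) x = - f x. Proof. by []. Qed.
Lemma endo1 x : (1 : endo V) x = x. Proof. by []. Qed.
Lemma endoM f g x : (f * g) x = g (f x). Proof. by []. Qed.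

End EndoRing.

Definition generated_subring (A : pzRingType) (X : set A) : set A :=
  smallest (fun S : set A => subring_closed (mem S)) X.

Definition fg_equiv (A : pzRingType) (S1 S2 : set A) : Prop :=
  exists U U' : set A,
    [/\ finite_set U, finite_set U',
        S1 `<=` generated_subring (S2 `|` U)
      & S2 `<=` generated_subring (S1 `|` U')].

Notation "S1 ≈ S2" := (fg_equiv S1 S2) (at level 70, no associativity).

(* The sum of the summands of [dsum I M] with index in [A]; in particular,
   [summands M [set i]] is the [i]-th copy of [M] inside [dsum I M]
   (lemma [summands1E]). *)
Definition summands (R : pzRingType) (I : Type) (M : lmodType R) (A : set I) :
  set (dsum I M) := [set x | forall i, ~ A i -> x i = 0].
Arguments summands {R I} M A.

Section Summands.
Context (R : pzRingType) (I : eqType) (M : lmodType R).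
Implicit Types (i j : I) (m : M) (x : dsum I M) (A : set I).

Fact dsum_inj_finite i m :
  (fun j => if j == i then m else 0) \in @finite_support I M.
Proof.
apply/asboolP; apply: sub_finite_set (finite_set1 i) => j /=.
by case: (eqVneq j i) => // _; rewrite eqxx.
Qed.

Definition dsum_inj i m : dsum I M := DSum (dsum_inj_finite i m).

Lemma dsum_injE i m j : dsum_inj i m j = if j == i then m else 0.
Proof. by []. Qed.

Lemma dsum_ext (x y : dsum I M) : x =1 y -> x = y.
Proof. by move=> /funext xy; apply: val_inj. Qed.

Lemma summands1E i : summands M [set i] = range (dsum_inj i).
Proof.
apply/seteqP; split=> [x xi|_ [m _ <-] j /= /eqP/negPf ji]; last first.
  by rewrite ji.
exists (x i) => //; apply: dsum_ext => j /=.
by case: (eqVneq j _) => [->//|/eqP ji]; rewrite xi.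
Qed.

Lemma summands_ind A (P : dsum I M -> Prop) :
    P 0 -> (forall x y, P x -> P y -> P (x + y)) ->
    (forall i m, A i -> P (dsum_inj i m)) ->
  forall x, summands M A x -> P x.
Proof.
move=> P0 PD PA x; have /asboolP/finite_seqP[s xs] := dsum_finite x.
have {xs} : forall i, i \notin s -> x i = 0.
  move=> i /negP si; apply/eqP/negPn/negP => xi.
  by apply: si; suff : [set` s] i by []; rewrite -xs.
elim: s x => [|a s IHs] x xs xA.
  by have -> : x = 0 by apply: dsum_ext => i; rewrite xs.
rewrite -(subrK (dsum_inj a (x a)) x).
have xaE j : (x - dsum_inj a (x a)) j = if j == a then 0 else x j.
  have -> : (x - dsum_inj a (x a)) j = x j - dsum_inj a (x a) j by [].
  by rewrite dsum_injE; case: (eqVneq j _) => [->|_]; rewrite ?subrr ?subr0.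
apply: (PD); first apply: IHs => j.
- by rewrite xaE; case: eqVneq => // ja js; rewrite xs // inE negb_or ja.
- by rewrite xaE => Aj; case: eqVneq => // _; apply: xA.
have [Aa|/xA ->] := pselect (A a); first exact: PA.
by have -> : dsum_inj a 0 = 0 by apply: dsum_ext => j; rewrite dsum_injE if_same.
Qed.

End Summands.

Definition upper_triangular (R : pzRingType) (d : Order.disp_t)
    (I : porderType d) (M : lmodType R) : set (endo (dsum I M)) :=
  [set f | forall i x, summands M [set i] x ->
             summands M [set j | (i <= j)%O] (f x)].
Arguments upper_triangular {R d} I M.

Lemma upper_triangular_subring (R : pzRingType) (d : Order.disp_t)
    (I : porderType d) (M : lmodType R) :
  subring_closed (mem (upper_triangular I M)).
Proof.
split=> [|f g /set_mem fT /set_mem gT|f g /set_mem fT /set_mem gT].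
- by apply/mem_set => i x xi j ij; apply: xi => /= ji; apply: ij; rewrite /= ji.
- apply/mem_set => i x xi j ij.
  have -> : (f - g) x j = f x j - g x j by [].
  by rewrite (fT i) // (gT i) // subrr.
apply/mem_set => i x xi; rewrite endoM.
apply: (summands_ind (P := g @^-1` summands M [set j | (i <= j)%O])) (fT i x xi).
- by move=> j _; rewrite /= linear0.
- move=> y z gy gz j ij; rewrite /= linearD.
  have -> : (g y + g z) j = g y j + g z j by [].
  by rewrite gy // gz // addr0.
move=> k m ik j ij; apply: (gT k); first by rewrite summands1E; exists m.
by move=> /= kj; apply: ij; apply: le_trans kj.
Qed.

Definition posnat : Type := {n : nat | (0 < n)%N}.
HB.instance Definition _ := Choice.on posnat.
HB.instance Definition _ := SubType.on posnat.
HB.instance Definition _ := [SubChoice_isSubOrder of posnat by <: with Order.NatOrder.nat_display].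
Lemma leEposnat (i j : posnat) : (i <= j)%O = (val i <= val j)%N.
Proof. by []. Qed.

(* Main.v *)
Require Import Defs.
From HB Require Import structures.
From mathcomp Require Import all_boot all_order all_algebra.
From mathcomp Require Import finmap boolp classical_sets functions cardinality.
From mathcomp Require Import fsbigop.

Import GRing.Theory.
Local Open Scope ring_scope.
Local Open Scope classical_set_scope.

(** Every endomorphism of [N] factors as [f = t * v] (first [t], then [v]) with
    [t] upper triangular and [v] one fixed endomorphism, so that adjoining the
    single element [v] to the upper triangular subring already gives all of [E].

    Fix a map [p] from the index set to itself all of whose fibres are cofinal,
    and let [v] carry the [k]-th copy of [M] identically onto the [p k]-th one.
    Given [f], choose for every pair [(i, j)] an index [c i j >= i] with
    [p (c i j) = j], and let [t] put the matrix entry [(i, j)] of [f] in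
    position [(i, c i j)].  Then [t] is upper triangular, and [v] moves
    every entry back to the column that it came from
    (lemma [upper_triangular_factorization]).

    On the positive integers the 2-adic valuation, with the value 0 replaced by
    1, is such a [p]: the number [2 ^ j * (2 * i + 1)] has valuation [j] and
    exceeds [i] (lemma [val2_fibre_cofinal]). *)

(** * Linear maps out of a direct sum *)

Section DirectSum.
Context {R : pzRingType} {I : choiceType} {M : lmodType R}.

Fact dsum_inj_is_linear (i : I) : linear (@dsum_inj R I M i).
Proof.
move=> a m n; apply: dsum_ext => j.
transitivity (a *: dsum_inj i m j + dsum_inj i n j); last by [].
by rewrite !dsum_injE; case: eqP => //; rewrite scaler0 addr0.
Qed.

HB.instance Definition _ i := GRing.isLinear.Build R M (dsum I M) *:%R
  (dsum_inj i) (dsum_inj_is_linear i).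

Lemma dsum_linear_ext {V : lmodType R} (f g : {linear dsum I M -> V}) :
  (forall i m, f (dsum_inj i m) = g (dsum_inj i m)) -> f =1 g.
Proof.
move=> fg x; apply: (summands_ind (A := setT) (P := fun y => f y = g y)) => //.
- by rewrite !linear0.
- by move=> y z fgy fgz; rewrite !linearD fgy fgz.
- by move=> i; case.
Qed.

(** The universal property of the direct sum: the map that is [g i] on the
    [i]-th summand. *)
Definition dsum_lift {V : lmodType R} (g : I -> {linear M -> V})
  (x : dsum I M) : V := \sum_(i \in [set: I]) g i (x i).

Section Lift.
Context {V : lmodType R} (g : I -> {linear M -> V}).

Lemma dsum_lift_finite (x : dsum I M) :
  finite_set [set i | g i (x i) != 0].
Proof.
have /asboolP := dsum_finite x; apply: sub_finite_set => i /=.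
by apply: contraNN => /eqP ->; rewrite linear0.
Qed.

Fact dsum_lift_is_linear : linear (dsum_lift g).
Proof.
move=> a x y; pose supp (z : dsum I M) := [set i | g i (z i) != 0].
pose S := supp x `|` supp y `|` supp (a *: x + y).
have finS : finite_set S by rewrite !finite_setU; do !split; apply: dsum_lift_finite.
(* All three sums may be taken over the common finite set [S]. *)
have liftE (z : dsum I M) : supp z `<=` S ->
    dsum_lift g z = \sum_(i <- fset_set S) g i (z i).
  move=> zS; rewrite /dsum_lift -fsbig_finite //; apply/esym/fsbig_widen => //.
  by move=> i [_ /= iS]; apply/eqP/negPn/negP => /zS.
rewrite !liftE; first last.
- by move=> i ?; right.
- by move=> i ?; left; left.
- by move=> i ?; left; right.
rewrite scaler_sumr -big_split; apply: eq_bigr => i _.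
exact: (linearP (g i) a (x i) (y i)).
Qed.

HB.instance Definition _ := GRing.isLinear.Build R (dsum I M) V *:%R
  (dsum_lift g) dsum_lift_is_linear.

Lemma dsum_lift_inj i m : dsum_lift g (dsum_inj i m) = g i m.
Proof.
rewrite /dsum_lift -(fsbig_widen [set i]) //.
  by rewrite fsbig_set1 dsum_injE eqxx.
by move=> j [_ /= /eqP/negPf ji]; rewrite /preimage/= ji linear0.
Qed.

End Lift.
End DirectSum.

Section Reindex.
Context {R : pzRingType} {M : lmodType R} {I J : choiceType}.

(** As a matrix, this is the 0-1 matrix of the map [h]. *)
Definition dsum_reindex (h : I -> J) : {linear dsum I M -> dsum J M} :=
  dsum_lift (fun i => dsum_inj (h i)).

Lemma dsum_reindex_inj h i m :
  dsum_reindex h (dsum_inj i m) = dsum_inj (h i) m.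
Proof. exact: dsum_lift_inj. Qed.

Lemma dsum_reindex_range (h : I -> J) x : summands M (range h) (dsum_reindex h x).
Proof.
apply: (summands_ind (A := setT)
  (P := fun y => summands M (range h) (dsum_reindex h y))) => //.
- by rewrite linear0.
- move=> y z hy hz j hj; rewrite linearD.
  transitivity (dsum_reindex h y j + dsum_reindex h z j); first by [].
  by rewrite hy // hz // addr0.
- move=> i m _ j hj; rewrite dsum_reindex_inj dsum_injE.
  by case: eqP => // jE; case: hj; rewrite jE; exists i.
- by move=> i; case.
Qed.

End Reindex.

(** * Factoring out one fixed endomorphism *)

(** The fibre of [p] over [j] contains, for each row [i], a position on or above
    the diagonal where the entry of column [j] can be parked.  Row [i] of [t] is
    row [i] of [f] followed by a relabelling of the summands, so it takes values
    in the direct sum because [f] does. *)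
Lemma upper_triangular_factorization {R : pzRingType} {d : Order.disp_t}
    {I : porderType d} {M : lmodType R} (p : I -> I)
    (p_cofinal : forall i j, exists2 k, (i <= k)%O & p k = j)
    (f : endo (dsum I M)) :
  exists2 t : endo (dsum I M), upper_triangular I M t &
    f = t * (dsum_reindex p : endo (dsum I M)).
Proof.
have cofinal_choice i : exists ci, forall j, (i <= ci j)%O /\ p (ci j) = j.
  have row_i j : exists k, (i <= k)%O /\ p k = j.
    by have [k ik pk] := p_cofinal i j; exists k.
  by have [ci ciP] := boolp.choice row_i; exists ci.
have [c cP] := boolp.choice cofinal_choice.
pose t : {linear dsum I M -> dsum I M} :=
  dsum_lift (fun i => dsum_reindex (c i) \o (f : {linear _ -> _}) \o dsum_inj i).
have tE i m : t (dsum_inj i m) = dsum_reindex (c i) (f (dsum_inj i m)).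
  exact: dsum_lift_inj.
exists t.
  move=> i x; rewrite summands1E => -[m _ <-] j ij; rewrite tE.
  apply: dsum_reindex_range => -[k _ kj]; apply: ij => /=.
  by rewrite -kj; case: (cP i k).
apply: endo_ext; apply: dsum_linear_ext => i m; rewrite endoM tE.
(* Column by column, [p] undoes [c i]. *)
apply/esym; apply: (dsum_linear_ext (dsum_reindex p \o dsum_reindex (c i)) idfun).
by move=> j n /=; rewrite !dsum_reindex_inj; case: (cP i j) => _ ->.
Qed.

Lemma upper_triangular_fg_equiv {R : pzRingType} {d : Order.disp_t}
    {I : porderType d} (M : lmodType R) (p : I -> I)
    (p_cofinal : forall i j, exists2 k, (i <= k)%O & p k = j) :
  upper_triangular I M ≈ [set: endo (dsum I M)].
Proof.
exists set0, [set (dsum_reindex p : endo (dsum I M))]; split=> //.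
  by move=> f _; apply: sub_gen_smallest; left.
move=> f _; have [t tT ->] := upper_triangular_factorization p p_cofinal f.
move=> S [[_ _ SM] XS]; apply/set_mem/SM; apply/mem_set/XS; first by left.
by right.
Qed.

(** * The positive integers *)

Definition posnat1 : posnat := Sub 1%N isT.

Definition val2 (k : posnat) : posnat := insubd posnat1 (logn 2 (val k)).

Lemma val2_fibre_cofinal (i j : posnat) :
  exists2 k : posnat, (i <= k)%O & val2 k = j.
Proof.
have k_gt0 : (0 < 2 ^ val j * (val i).*2.+1)%N by rewrite muln_gt0 expn_gt0.
exists (Sub _ k_gt0).
  rewrite leEposnat SubK (@leq_trans (val i).*2.+1) ?leq_pmull ?expn_gt0 //.
  by rewrite -addnn leqW // leq_addr.
apply: val_inj; rewrite /val2 SubK lognM ?expn_gt0 // pfactorK //.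
rewrite (@lognE 2 _.+1) dvdn2 /= odd_double /= addn0.
by rewrite val_insubd (valP j).
Qed.

Theorem corollary13 (R : pzRingType) (M : lmodType R)
    (M_neq0 : exists m : M, m != 0) (M_fg : finitely_generated M) :
  upper_triangular posnat M ≈ [set: endo (dsum posnat M)].
Proof. exact: upper_triangular_fg_equiv val2_fibre_cofinal. Qed.
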